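(* Let $t\in\mathbb{Z}_{\ge 0}$ and let $m,n$ be positive integers with $t\le m\le n$. Let $Y$ be a Young diagram having at most $t$ rows. Then $Y\in\mathcal{S}(Y_{m,n})$ if and only if $Y\in\mathcal{S}(Y_{t,n-m+t})$. Moreover, in this case, the Grundy value of $Y$ as an element of $\mathcal{S}(Y_{m,n})$ (i.e. in MHRG with starting position $Y_{m,n}$) is equal to the Grundy value of $Y$ as an element of $\mathcal{S}(Y_{t,n-m+t})$ (i.e. in MHRG with starting position $Y_{t,n-m+t}$).
   Context: Young diagrams. A Young diagram is a finite set $Y=\{(i,j)\in\mathbb{N}^2\mid 1\le j\le\lambda_i\}$ with $\lambda_1\ge\lambda_2\ge\cdots\ge 0$ integers, almost all zero ($\mathbb{N}$ = positive integers); it has at most $t$ rows if $\lambda_i=0$ for $i>t$. $\emptyset$ is the empty Young diagram. For positive integers $a\le b$, $Y_{a,b}=\{(i,j)\mid 1\le i\le a,\ 1\le j\le b\}$ is the rectangular diagram and $\mathcal{F}(Y_{a,b})$ is the set of all Young diagrams contained in $Y_{a,b}$. Hooks. For $(i,j)\in Y$, the hook at $(i,j)$ is $H_Y(i,j)=\{(i,j)\}\cup\{(i,j')\in Y\mid j'>j\}\cup\{(i',j)\in Y\mid i'>i\}$. Removing it gives the Young diagram $Y\langle i,j\rangle=\{(i',j')\in Y\mid i'<i\text{ or }j'<j\}\cup\{(i'-1,j'-1)\mid (i',j')\in Y,\ i'>i\text{ and }j'>j\}$. Multiple Hook Removing Game (MHRG) with starting position $Y_{a,b}$ ($1\le a\le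 b$). The box $(i,j)$ carries the number $c(i,j)=\min(j-i+a,\ i-j+b)$ (unimodal numbering, depending on $(a,b)$). For $Y\in\mathcal{F}(Y_{a,b})$ and $(i,j)\in Y$, $\mathcal{H}_Y(i,j)$ denotes the multiset of the numbers $c(p,q)$ for $(p,q)\in H_Y(i,j)$. Positions are diagrams in $\mathcal{F}(Y_{a,b})$; the starting position is $Y_{a,b}$. From a position $Y\ne\emptyset$ the player chooses a box $(i,j)\in Y$ and forms $Y\langle i,j\rangle$. It is known that there is at most one box $(i',j')\in Y\langle i,j\rangle$ with $\mathcal{H}_{Y\langle i,j\rangle}(i',j')=\mathcal{H}_Y(i,j)$ as multisets. If there is none, the player moves from $Y$ to $Y\langle i,j\rangle$; if there is one, the player moves from $Y$ to $(Y\langle i,j\rangle)\langle i',j'\rangle$. The diagrams obtainable from $Y$ in one move are the options of $Y$; their set is $\mathcal{O}(Y)$. The unique ending position is $\emptyset$. $\mathcal{S}(Y_{a,b})$ is the set of all diagrams in $\mathcal{F}(Y_{a,b})$ that can be reached from $Y_{a,b}$ by a (possibly empty) finite sequence of moves. Grundy value. $\mathcal{G}(\emptyset)=0$, and for $Y\neq\emptyset$, $\mathcal{G}(Y)=\mathrm{mex}\{\mathcal{G}(P)\mid P\in\mathcal{O}(Y)\}$, where $\mathrm{mex}\,X=\min(\mathbb{Z}_{\ge 0}\setminus X)$. Convention for $t=0$: $Y_{0,n-m}=\emptyset$ and $\mathcal{S}(Y_{0,n-m})=\{\emptyset\}$, with $\emptyset$ having Grundy value $0$. *)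

(* Defs.v *)
From mathcomp Require Import all_boot all_order all_algebra.
From mathcomp Require Import finmap multiset.

Set Implicit Arguments.
Unset Strict Implicit.
Unset Printing Implicit Defensive.

Import Order.TTheory GRing.Theory Num.Theory.

Local Open Scope nat_scope.
Local Open Scope fset_scope.

(* A box is a pair (row, column); both coordinates are counted from 1. *)
Definition box : Type := (nat * nat)%type.

(* [lam] is only meaningful at indices >= 1; the value [lam 0] is irrelevant. *)
Definition is_shape (lam : nat -> nat) (Y : {fset nat * nat}) : Prop :=
  [/\ forall i, 1 <= i -> lam i.+1 <= lam i,
      exists N, forall i, N < i -> lam i = 0
    & forall i j, ((i, j) \in Y) = [&& 1 <= i, 1 <= j & j <= lam i]].

Definition young (Y : {fset nat * nat}) : Prop :=
  exists lam, is_shape lam Y.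

Definition young_rows (t : nat) (Y : {fset nat * nat}) : Prop :=
  exists2 lam, is_shape lam Y & forall i, t < i -> lam i = 0.

Definition rect (a b : nat) : {fset nat * nat} :=
  [fset x in [seq (i, j) | i <- iota 1 a, j <- iota 1 b]].

Definition young_in (a b : nat) (Y : {fset nat * nat}) : Prop :=
  young Y /\ Y `<=` rect a b.

Definition hook (Y : {fset nat * nat}) (x : box) : {fset nat * nat} :=
  [fset x] `|` [fset y in Y | (y.1 == x.1) && (x.2 < y.2)]
           `|` [fset y in Y | (x.1 < y.1) && (y.2 == x.2)].

Definition remove_hook (Y : {fset nat * nat}) (x : box) : {fset nat * nat} :=
  [fset y in Y | (y.1 < x.1) || (y.2 < x.2)]
  `|` [fset (y.1.-1, y.2.-1) | y in [fset y in Y | (x.1 < y.1) && (x.2 < y.2)]].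

Definition numbering (a b : nat) (x : box) : int :=
  Num.min (x.2%:Z - x.1%:Z + a%:Z)%R (x.1%:Z - x.2%:Z + b%:Z)%R.

Definition hook_numbers (a b : nat) (Y : {fset nat * nat}) (x : box)
    : {mset int}%mset :=
  seq_mset [seq numbering a b y | y <- hook Y x].

(* The boxes of [remove_hook Y x] whose hook carries the same numbers as the
   hook at [x] in [Y]; for a position [Y] of the game there is at most one. *)
Definition twins (a b : nat) (Y : {fset nat * nat}) (x : box) : seq box :=
  let Z := remove_hook Y x in
  [seq y <- Z | hook_numbers a b Z y == hook_numbers a b Y x].

Definition moves (a b : nat) (Y : {fset nat * nat}) (x : box)
    : seq {fset nat * nat} :=
  let Z := remove_hook Y x in
  if twins a b Y x is [::] then [:: Z]
  else [seq remove_hook Z y | y <- twins a b Y x].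

Definition options (a b : nat) (Y : {fset nat * nat})
    : seq {fset nat * nat} :=
  flatten [seq moves a b Y x | x <- Y].

Definition reachable (a b : nat) (Y : {fset nat * nat}) : Prop :=
  exists2 s : seq {fset nat * nat},
    path (fun P Q => Q \in options a b P) (rect a b) s
    & last (rect a b) s = Y.

Definition positions (a b : nat) (Y : {fset nat * nat}) : Prop :=
  young_in a b Y /\ reachable a b Y.

Lemma mex_subproof (s : seq nat) : exists n, n \notin s.
Proof.
exists (\max_(k <- s) k).+1; apply/negP => /(@leq_bigmax_seq _ s predT id).
by rewrite ltnn => /(_ isT).
Qed.

Definition mex (s : seq nat) : nat := ex_minn (mex_subproof s).

(* Recursion on the number of boxes, which every move decreases; the defining
   equation of the Grundy value is [grundyE] below. *)
Fixpoint grundy_rec (a b k : nat) (Y : {fset nat * nat}) : nat :=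
  if k is k'.+1 then mex [seq grundy_rec a b k' P | P <- options a b Y] else 0.

Definition grundy (a b : nat) (Y : {fset nat * nat}) : nat :=
  grundy_rec a b #|` Y| Y.

Lemma mex_nil : mex [::] = 0.
Proof. by rewrite /mex; case: ex_minnP => [[|n]] // _ /(_ 0 isT). Qed.

Lemma remove_hook_card Y x : x \in Y -> #|` remove_hook Y x| < #|` Y|.
Proof.
move=> xY; set A := [fset y in Y | (y.1 < x.1) || (y.2 < x.2)].
set B := [fset y in Y | (x.1 < y.1) && (x.2 < y.2)].
have AB0 : [disjoint A & B]%fset.
  apply/fdisjointP => y; rewrite !inE /= => /andP[_ h]; apply/negP.
  by move=> /andP[_ /andP[h1 h2]]; case/orP: h => /ltnW; rewrite leqNgt ?h1 ?h2.
have sAB : A `|` B `<=` Y `\ x.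
  apply/fsubsetP => y; rewrite !inE /= -andb_orr => /andP[-> h].
  by rewrite andbT; apply: contraTneq h => ->; rewrite !ltnn.
rewrite [X in _ < X](cardfsD1 x) xY add1n ltnS.
apply: leq_trans (fsubset_leq_card sAB).
rewrite [X in _ <= X]cardfsU (eqP (AB0 : A `&` B == fset0)) cardfs0 subn0.
rewrite /remove_hook -/A -/B.
apply: leq_trans (_ : #|` A| + #|` [fset (y.1.-1, y.2.-1) | y in B]| <= _).
  by rewrite cardfsU leq_subr.
by rewrite leq_add2l; apply: leq_imfset_card.
Qed.

Lemma options_card a b Y P : P \in options a b Y -> #|` P| < #|` Y|.
Proof.
case/flattenP => s /mapP[x xY ->]; rewrite /moves.
have lt1 := remove_hook_card xY.
have tw y : y \in twins a b Y x -> y \in remove_hook Y x.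
  by rewrite mem_filter => /andP[].
case: (twins a b Y x) tw => [|z r] tw; first by rewrite inE => /eqP ->.
case/mapP => y /tw yZ ->; exact: ltn_trans (remove_hook_card yZ) lt1.
Qed.

Lemma grundy_rec_fuel a b k Y :
  #|` Y| <= k -> grundy_rec a b k Y = grundy a b Y.
Proof.
rewrite /grundy; have [N] := ubnP k; elim: N k Y => // N IH k Y ltkN leYk.
have opt0 : #|` Y| = 0 -> options a b Y = [::].
  by move/eqP; rewrite cardfs_eq0 => /eqP ->.
case: k ltkN leYk => [|k] ltkN leYk.
  by move: leYk; rewrite leqn0 => /eqP ->.
case E : #|` Y| => [|c] /=; first by rewrite opt0 // mex_nil.
congr mex; apply/eq_in_map => P /options_card; rewrite E ltnS => lePc.
have leck : c <= k by rewrite -ltnS -E.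
rewrite (IH k) ?(leq_trans lePc) // (IH c) //.
exact: leq_ltn_trans leck ltkN.
Qed.

Lemma grundyE a b Y :
  grundy a b Y = mex [seq grundy a b P | P <- options a b Y].
Proof.
rewrite -(@grundy_rec_fuel a b #|` Y|.+1) //=.
congr mex; apply/eq_in_map => P /options_card ltPY.
by rewrite grundy_rec_fuel // ltnW.
Qed.

(* Main.v *)
Require Import Defs.
From mathcomp Require Import all_boot all_order all_algebra.
From mathcomp Require Import finmap multiset.
From mathcomp Require Import zify.
From Stdlib Require Import Classical_Prop.

Set Implicit Arguments.
Unset Strict Implicit.
Unset Printing Implicit Defensive.

Import Order.TTheory GRing.Theory Num.Theory.

Local Open Scope fset_scope.
Local Open Scope nat_scope.

(** Encode a diagram with row lengths [lam] by its beads, the integers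
    [lam i - i] for [i >= 1] (a Maya diagram, so that all sufficiently negative
    integers are beads).  Removing a hook whose contents fill the interval
    [v + 1 .. u] moves the bead [u] to the vacant place [v] ([bead_cut]), and
    every bead can be moved in this way to every vacant place below it
    ([hook_of_beads]).

    Put [d = b - a].  The unimodal numbering of a box of content [c] is
    [min (c + a) (b - c)], which is invariant under [c |-> d - c].  An interval
    of contents is therefore determined by its numbers up to this reflection
    ([folded_rangeP]), and on beads the reflection is [z |-> d - 1 - z].  Hence,
    after the bead [u] has gone to [v], the only possible second hook is the one
    that carries the bead [d - 1 - v] to [d - 1 - u] ([twinsP]).

    Call a diagram balanced when no bead [z] has its antipode [d - 1 - z] among
    the beads.  The rectangle is balanced, and a move keeps this property: if
    the first half of a move creates an antipodal pair, then the second half is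
    forced and destroys it ([balanced_options]).  Conversely, a balanced diagram
    with at most [a] rows fits in the rectangle and is reached from it
    ([reachable_of_balanced]): unless it is the whole rectangle, adding a box in
    its first short row, followed if necessary by the reflected box, undoes a
    move and gives a larger balanced diagram ([predecessor]).

    So the positions of the game are exactly the balanced diagrams with at most
    [a] rows ([positionsP]), and being balanced depends on [b - a] alone, which
    is the same for the two games; this gives the equivalence.  As for Grundy
    values, passing from [(a, b)] to [(a + c, b + c)] adds [c] to every number,
    which leaves all comparisons of hooks, hence all options, unchanged
    ([options_shift]). *)

(** * Diagrams and their row lengths *)

Lemma shape_mono lam Y i k : is_shape lam Y -> 0 < i -> i <= k -> lam k <= lam i.
Proof.
move=> [dec _ _] i0; elim: k => [|k IH] le_ik; first lia.
have [->//|lt_ik] := eqVneq i k.+1.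
by apply: leq_trans (dec k _) (IH _); lia.
Qed.

Lemma shape_ext lam mu Y Z :
  is_shape lam Y -> is_shape mu Z -> (forall i, 0 < i -> lam i = mu i) -> Y = Z.
Proof.
move=> [_ _ memY] [_ _ memZ] eq_lm; apply/fsetP => -[i j].
by rewrite memY memZ; case: i => //= i; rewrite eq_lm.
Qed.

Lemma shape_inj lam mu Y :
  is_shape lam Y -> is_shape mu Y -> forall i, 0 < i -> lam i = mu i.
Proof.
move=> [_ _ memY] [_ _ memY'] i i0; apply/eqP; rewrite eqn_leq; apply/andP; split.
  case E : (lam i) => [//|k]; have := memY i k.+1.
  by rewrite memY' i0 E leqnn /= => /esym /= <-.
case E : (mu i) => [//|k]; have := memY' i k.+1.
by rewrite memY i0 E leqnn /= => /esym /= <-.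
Qed.

(** * Beads and hooks *)

Definition bead (lam : nat -> nat) (z : int) : Prop :=
  exists2 i, 0 < i & (z = (lam i)%:Z - i%:Z)%R.

(** The hook at [(i, j)] has its foot in row [l]; carrying [l] along avoids
    conjugate partitions. *)
Definition hook_span (lam : nat -> nat) (i j l : nat) : bool :=
  [&& 0 < i, i <= l, 0 < j, j <= lam l & lam l.+1 < j].

(** [head] is the largest content in the hook and [tail] is one less than the
    smallest: the bead that the removal of the hook moves, and its
    destination. *)
Definition head (lam : nat -> nat) (i : nat) : int := ((lam i)%:Z - i%:Z)%R.
Definition tail (j l : nat) : int := (j%:Z - 1 - l%:Z)%R.

Lemma hook_spanE lam Y i j :
  is_shape lam Y -> (i, j) \in Y -> exists l, hook_span lam i j l.
Proof.
move=> shY; have [dec [N lam0] memY] := shY.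
rewrite memY => /and3P[i0 j0 le_j].
have ex : exists l, (i <= l) && (j <= lam l) by exists i; rewrite leqnn.
have bd l : (i <= l) && (j <= lam l) -> l <= N.
  by case/andP => _; rewrite leqNgt [l <= N]leqNgt; apply: contra => /lam0 ->.
have [l /andP[le_il le_jl] maxl] := ex_maxnP ex bd.
exists l; rewrite /hook_span i0 le_il j0 le_jl /= ltnNge; apply/negP => h.
by have := maxl l.+1; rewrite h leqW // ltnn => /(_ isT).
Qed.

Lemma hook_span_mem lam Y i j l :
  is_shape lam Y -> hook_span lam i j l -> (i, j) \in Y.
Proof.
move=> shY /and5P[i0 le_il j0 le_j _]; have [_ _ ->] := shY.
by rewrite i0 j0 (leq_trans le_j) // (shape_mono shY).
Qed.

Lemma hook_span_leg lam Y i j l k :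
  is_shape lam Y -> hook_span lam i j l -> 0 < k -> (j <= lam k) = (k <= l).
Proof.
move=> shY /and5P[i0 le_il j0 le_j gt_j] k0; apply/idP/idP => [h|h].
  rewrite leqNgt; apply/negP => lt_lk; move: gt_j; rewrite ltnNge => /negP[].
  by apply: leq_trans h (shape_mono shY _ _).
exact: leq_trans le_j (shape_mono shY _ _).
Qed.

(** Removing a rim hook between rows [i] and [l] shifts the intermediate rows
    up by one along the diagonal; row [l] keeps the boxes left of column [j]. *)
Definition cut (lam : nat -> nat) (i j l k : nat) : nat :=
  if k < i then lam k else if k < l then (lam k.+1).-1
  else if k == l then j.-1 else lam k.

Lemma remove_hook_shape lam Y i j l :
  is_shape lam Y -> hook_span lam i j l ->
  is_shape (cut lam i j l) (remove_hook Y (i, j)).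
Proof.
move=> shY sp; have leg k : 0 < k -> (j <= lam k) = (k <= l) by exact: hook_span_leg shY sp.
have mono p q : 0 < p -> p <= q -> lam q <= lam p by exact: shape_mono shY.
have [dec [N lam0] memY] := shY; have /and5P[i0 le_il j0 le_j gt_j] := sp.
split.
- move=> k k0; have := dec k k0; have := dec k.+1 isT; have := leg k k0.
  have := leg k.+1 isT; have := leg k.+2 isT.
  rewrite /cut; repeat case: ifP; lia.
- exists (N + l) => k lt_k; rewrite /cut ltnNge (_ : i <= k) /=; last by lia.
  rewrite ltnNge (_ : l <= k) /=; last by lia.
  have [e|_] := eqVneq k l; first by have := leg l; rewrite -e lam0; lia.
  by apply: lam0; lia.
move=> p q; apply/idP/idP.
  rewrite !inE /= => /orP[|/imfsetP[[p' q'] /=]].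
    rewrite memY => /andP[/and3P[p0 q0 le_q] h]; rewrite p0 q0 /=.
    have := leg p p0; have := leg p.+1 isT; have := dec p p0; rewrite /cut.
    repeat case: ifP; lia.
  rewrite !inE /= memY => /andP[/and3P[p0 q0 le_q] /andP[lt_p lt_q]] [-> ->].
  have p'E : p'.-1.+1 = p' by lia.
  have := leg p' p0; rewrite /cut p'E.
  have := mono p'.-1 p'; case: ifP; first lia.
  repeat case: ifP; lia.
move=> /and3P[p0 q0 le_q]; rewrite !inE /= memY p0 q0 /=.
have := leg p p0; have := leg p.+1 isT => legS legp; move: le_q; rewrite /cut.
have [lt_pi|le_ip] := ltnP p i; first by move=> ->.
have [lt_pl|le_lp] := ltnP p l; last first.
  by case: ifP => [/eqP->|ne] h; apply/orP; left; lia.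
have [lt_qj|le_jq] := ltnP q j => h; apply/orP; [left|right].
  have := dec p p0; lia.
apply/imfsetP; exists (p.+1, q.+1) => //=; rewrite !inE /= memY; lia.
Qed.

Definition shift_bead (B : int -> Prop) (u v z : int) : Prop :=
  B z /\ z <> u \/ z = v.

Lemma bead_lt lam Y i k : is_shape lam Y -> 0 < i -> i < k ->
  (head lam k < head lam i)%R.
Proof.
by move=> shY i0 lt_ik; have := shape_mono shY i0 (ltnW lt_ik); rewrite /head; lia.
Qed.

(** The rows strictly between [i] and [l] move along diagonals, so they keep
    their beads; only [head lam i] disappears, and row [l] brings [tail j l]. *)
Lemma bead_cut lam Y i j l :
  is_shape lam Y -> hook_span lam i j l ->
  forall z, bead (cut lam i j l) z <-> shift_bead (bead lam) (head lam i) (tail j l) z.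
Proof.
move=> shY sp z; have leg k : 0 < k -> (j <= lam k) = (k <= l) by exact: hook_span_leg shY sp.
have /and5P[i0 le_il j0 le_j gt_j] := sp; split.
  case=> k k0 ->; rewrite /cut.
  have [lt_ki|le_ik] := ltnP k i.
    by left; split; [exists k | have := bead_lt shY k0 lt_ki; rewrite /head; lia].
  have [lt_kl|le_lk] := ltnP k l.
    have := leg k.+1 isT => legS.
    left; split; first by exists k.+1 => //; lia.
    by have := bead_lt shY i0 (le_ik : i < k.+1); rewrite /head; lia.
  case: eqVneq => [->|ne]; first by right; rewrite /tail; lia.
  left; split; first by exists k.
  by have := @bead_lt _ _ i k shY i0; rewrite /head; lia.
case=> [[[k k0 ->] ne]|->]; last by exists l; rewrite ?/cut ?eqxx ?ltnn /tail; repeat case: ifP; lia.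
have neki : k <> i by move=> e; apply: ne; rewrite e.
have [lt_ki|le_ik] := ltnP k i; first by exists k; rewrite // /cut lt_ki.
have [le_kl|lt_lk] := leqP k l.
  exists k.-1; first lia.
  have kE : k.-1.+1 = k by lia.
  have := leg k k0; rewrite /cut kE; case: ifP; first lia.
  by case: ifP; lia.
by exists k => //; rewrite /cut; repeat case: ifP; lia.
Qed.

Lemma bead_tail lam Y i j l :
  is_shape lam Y -> hook_span lam i j l -> ~ bead lam (tail j l).
Proof.
move=> shY sp [k k0 e]; have := hook_span_leg shY sp k0; rewrite /tail in e; lia.
Qed.

(** The foot of the hook is the last row whose bead lies above [v]; the column
    is then forced by [tail j l = v]. *)
Lemma hook_of_beads lam Y (u v : int) :
  is_shape lam Y -> bead lam u -> ~ bead lam v -> (v < u)%R ->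
  exists i j l, [/\ hook_span lam i j l, head lam i = u & tail j l = v].
Proof.
move=> shY [i i0 uE] Nv lt_vu.
pose P l := (0 < l) && (v < head lam l)%R.
have exP : exists l, P l by exists i; rewrite /P i0 /head -uE.
have bd l : P l -> l <= lam 1 + absz v.
  case/andP=> l0; have := shape_mono shY (isT : 0 < 1) l0; rewrite /head; lia.
have [l /andP[l0 lt_vl] maxl] := ex_maxnP exP bd.
have le_il : i <= l by apply: maxl; rewrite /P i0 /head -uE.
have NPS : (head lam l.+1 < v)%R.
  rewrite ltNge le_eqVlt; apply/negP => /orP[/eqP e|h].
    by apply: Nv; exists l.+1.
  by have := maxl l.+1; rewrite /P h => /(_ isT); lia.
exists i, (absz (v + 1 + l%:Z)%R), l; rewrite /hook_span /tail /head -uE in lt_vl NPS *.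
split=> //; lia.
Qed.

(** * Numbers along a hook *)

Definition content (y : box) : int := (y.2%:Z - y.1%:Z)%R.

Definition int_range (v u : int) : seq int :=
  [seq (v + k.+1%:Z)%R | k <- iota 0 (absz (u - v)%R)].

Lemma mem_int_range v u c : (v <= u)%R -> (c \in int_range v u) = (v < c <= u)%R.
Proof.
move=> le_vu; apply/mapP/idP => [[k]|h]; first by rewrite mem_iota => ?; lia.
by exists (absz (c - v - 1)%R); rewrite ?mem_iota; lia.
Qed.

Lemma int_range_uniq v u : uniq (int_range v u).
Proof. by rewrite map_inj_uniq ?iota_uniq // => x y; lia. Qed.

(** Going from the foot of the hook up the leg and then along the arm, the
    content increases by one at each box. *)
Lemma hook_contents lam Y i j l :
  is_shape lam Y -> hook_span lam i j l ->
  (tail j l < head lam i)%R /\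
  perm_eq [seq content y | y <- hook Y (i, j)]
          (int_range (tail j l) (head lam i)).
Proof.
move=> shY sp; have leg k : 0 < k -> (j <= lam k) = (k <= l) by exact: hook_span_leg shY sp.
have [_ _ memY] := shY; have /and5P[i0 le_il j0 le_j gt_j] := sp.
have le_ji : j <= lam i by rewrite leg.
have lt_tu : (tail j l < head lam i)%R by rewrite /tail /head; lia.
have memH p q : ((p, q) \in hook Y (i, j)) =
    (p == i) && (j <= q <= lam i) || (q == j) && (i < p <= l).
  rewrite !inE /= memY xpair_eqE; have := leg p.
  have [->|] := eqVneq p i; have [->|] := eqVneq q j; lia.
split=> //; apply: uniq_perm.
- rewrite map_inj_in_uniq ?fset_uniq // => -[p q] [p' q'].
  rewrite !memH /content /= => h h' e.
  have [-> ->] : p = p' /\ q = q' by lia.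
  by [].
- exact: int_range_uniq.
move=> c; rewrite (mem_int_range _ (ltW lt_tu)); apply/idP/idP => [/mapP[[p q]]|].
  by rewrite memH /content /tail /head /=; have := leg p; lia.
rewrite /tail /head => h; apply/mapP; have [le|lt] := leP (j%:Z - i%:Z)%R c.
  by exists (i, absz (c + i%:Z)%R); rewrite ?memH /content /=; lia.
by exists (absz (j%:Z - c)%R, j); rewrite ?memH /content /=; lia.
Qed.

Lemma hook_numbersE a b Y x :
  hook_numbers a b Y x =
  seq_mset [seq Num.min (c + a%:Z)%R (b%:Z - c)%R
           | c <- [seq content y | y <- hook Y x]].
Proof.
rewrite /hook_numbers -map_comp; congr seq_mset; apply: eq_map => y.
by rewrite /numbering /content /=; lia.
Qed.

Lemma int_range_reflect v u (d : int) : (v < u)%R ->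
  perm_eq (int_range (d - 1 - u)%R (d - 1 - v)%R)
          [seq (d - c)%R | c <- int_range v u].
Proof.
move=> lt_vu; apply: uniq_perm; first exact: int_range_uniq.
  by rewrite map_inj_uniq ?int_range_uniq // => x y; lia.
move=> c; rewrite mem_int_range; last by lia.
apply/idP/idP => [h|/mapP[c']].
  by apply/mapP; exists (d - c)%R; rewrite ?(mem_int_range _ (ltW lt_vu)); lia.
by rewrite (mem_int_range _ (ltW lt_vu)); lia.
Qed.

(** The numbers of an interval give its length, and the least of them is taken
    at one of its two ends because [f] is unimodal.  Length and minimum fix
    either the lower end or, by symmetry, the upper one. *)
Lemma folded_rangeP (a b : nat) (v u v' u' : int) :
  (v < u)%R -> (v' < u')%R ->
  let f c := Num.min (c + a%:Z)%R (b%:Z - c)%R in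
  let d : int := (b%:Z - a%:Z)%R in
  perm_eq [seq f c | c <- int_range v u] [seq f c | c <- int_range v' u'] <->
  (u' = u /\ v' = v) \/ (u' = d - 1 - v /\ v' = d - 1 - u)%R.
Proof.
move=> lt_vu lt_vu' f d; split=> [eq_f|].
  have := perm_size eq_f; rewrite !size_map !size_iota => eq_sz.
  have mem_f w x c : (w < x)%R -> (w < c <= x)%R -> f c \in [seq f c | c <- int_range w x].
    by move=> lt_wx h; rewrite map_f // (mem_int_range _ (ltW lt_wx)).
  have low w x y : (w < x)%R -> y \in [seq f c | c <- int_range w x] ->
      (Num.min (w + 1 + a%:Z) (b%:Z - x) <= y)%R.
    by move=> lt_wx /mapP[c]; rewrite (mem_int_range _ (ltW lt_wx)) /f; lia.
  have m1 : f (v + 1)%R \in [seq f c | c <- int_range v' u'].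
    by rewrite -(perm_mem eq_f) mem_f //; lia.
  have m2 : f u \in [seq f c | c <- int_range v' u'].
    by rewrite -(perm_mem eq_f) mem_f //; lia.
  have m3 : f (v' + 1)%R \in [seq f c | c <- int_range v u].
    by rewrite (perm_mem eq_f) mem_f //; lia.
  have m4 : f u' \in [seq f c | c <- int_range v u].
    by rewrite (perm_mem eq_f) mem_f //; lia.
  have := low _ _ _ lt_vu' m1; have := low _ _ _ lt_vu' m2.
  have := low _ _ _ lt_vu m3; have := low _ _ _ lt_vu m4.
  rewrite /f /d; lia.
case=> -[-> ->]; first exact: perm_refl.
rewrite perm_sym; apply: perm_trans (perm_map f (int_range_reflect d lt_vu)) _.
rewrite -map_comp (_ : map _ _ = [seq f c | c <- int_range v u]) ?perm_refl //.
by apply: eq_map => c; rewrite /f /d /=; lia.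
Qed.

Lemma hook_numbersP a b lam mu Y Z i j l i' j' l' :
  is_shape lam Y -> hook_span lam i j l ->
  is_shape mu Z -> hook_span mu i' j' l' ->
  let d : int := (b%:Z - a%:Z)%R in
  hook_numbers a b Z (i', j') = hook_numbers a b Y (i, j) <->
  (head mu i' = head lam i /\ tail j' l' = tail j l) \/
  (head mu i' = d - 1 - tail j l /\ tail j' l' = d - 1 - head lam i)%R.
Proof.
move=> shY sp shZ sp' d.
have [lt1 eq1] := hook_contents shY sp; have [lt2 eq2] := hook_contents shZ sp'.
rewrite -(folded_rangeP a b lt1 lt2) !hook_numbersE.
set f := fun c => _; split=> [/esym/eq_seq_msetP|] eq_f; last apply/esym/eq_seq_msetP.
  apply: perm_trans (perm_map f eq2); apply: perm_trans eq_f.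
  by apply: perm_map; rewrite perm_sym.
apply: perm_trans (perm_map f eq1) _; apply: perm_trans eq_f _.
by apply: perm_map; rewrite perm_sym.
Qed.

(** * Sets of beads without antipodal pairs *)

Definition antipode_free (d : int) (B : int -> Prop) : Prop :=
  forall z, B z -> ~ B (d - 1 - z)%R.

Lemma antipode_free_ext d (B C : int -> Prop) :
  (forall z, C z <-> B z) -> antipode_free d B -> antipode_free d C.
Proof. by move=> eqCB free z /eqCB Bz /eqCB; apply: free. Qed.

(** Moving [u] to [v] and the antipode of [v] to the antipode of [u] vacates
    both antipodes of the new places.  The degenerate cases, in which the two
    moves share the place fixed by the reflection, are included: this is why
    both moves are expressed by [shift_bead] in succession. *)
Lemma antipode_free_double d B u v :
  antipode_free d B -> B u -> u <> v ->
  antipode_free d (shift_bead (shift_bead B u v) (d - 1 - v)%R (d - 1 - u)%R).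
Proof.
move=> free Bu neq_uv z; set C := shift_bead _ _ _ => Cz Cz'.
(* [u] is the antipode of the last place filled, and it stays vacant. *)
have NCu : ~ C u.
  case=> [[[[_ //]|//]]|e]; apply: (free u Bu); by rewrite -e.
case: (Cz) => [[Bz zv']|e]; last by apply: NCu; rewrite (_ : u = d - 1 - z)%R; [|lia].
case: (Cz') => [[Bz' zv]|e]; last by apply: NCu; rewrite (_ : u = z)%R; [|lia].
case: Bz => [[Bz _]|e]; last by apply: zv; rewrite e.
case: Bz' => [[Bz' _]|e]; last by apply: zv'; lia.
exact: free Bz Bz'.
Qed.

(** A single move can only create the pair formed by [v] and its antipode, and
    then the reflected move is available: the antipode of [u] is vacant since
    [u] was a bead. *)
Lemma antipode_free_single d B u v :
  antipode_free d B -> B u -> u <> v ->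
  antipode_free d (shift_bead B u v) \/
  shift_bead B u v (d - 1 - v)%R /\ ~ shift_bead B u v (d - 1 - u)%R.
Proof.
move=> free Bu neq_uv; have [?|Nfree] := classic (antipode_free d (shift_bead B u v)).
  by left.
right; have Nu := free u Bu.
split; last first.
  case=> [[]//|e]; apply: Nfree; rewrite /shift_bead => z [[Bz zu]|zv] [[Bz' zu']|zv'].
  - exact: free Bz Bz'.
  - by apply: zu; lia.
  - by apply: zu'; lia.
  - by lia.
apply: NNPP => N; apply: Nfree; rewrite /shift_bead => z [[Bz zu]|zv] [[Bz' zu']|zv'].
- exact: free Bz Bz'.
- by apply: N; left; rewrite -zv' (_ : d - 1 - _ = z)%R; [split | lia].
- by apply: N; left; rewrite -zv.
- by apply: N; right; lia.
Qed.

(** * Moves preserve balance *)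

(** Of the two intervals having the same numbers as the removed hook, the
    interval itself cannot be a hook any more, because its head [head lam i] is
    vacant after the removal. *)
Lemma twinsP a b lam Y i j l i' j' l' :
  let d : int := (b%:Z - a%:Z)%R in
  is_shape lam Y -> hook_span lam i j l ->
  hook_span (cut lam i j l) i' j' l' ->
  (i', j') \in twins a b Y (i, j) <->
  head (cut lam i j l) i' = (d - 1 - tail j l)%R /\
  tail j' l' = (d - 1 - head lam i)%R.
Proof.
move=> d shY sp sp'; have shZ := remove_hook_shape shY sp.
rewrite mem_filter (hook_span_mem shZ sp') andbT.
have := hook_numbersP a b shY sp shZ sp' => /= eqP'.
have neq : head (cut lam i j l) i' <> head lam i.
  move=> e; have : bead (cut lam i j l) (head lam i).
    by exists i'; rewrite -?e //; case/andP: sp'.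
  have [lt_tu _] := hook_contents shY sp.
  by move/(bead_cut shY sp) => [[]//|]; lia.
by split=> [/eqP/eqP'|h]; [tauto | apply/eqP/eqP'; right].
Qed.

Lemma bead_head lam i : 0 < i -> bead lam (head lam i).
Proof. by move=> i0; exists i. Qed.

Definition balanced (d : int) (Y : {fset nat * nat}) : Prop :=
  exists2 lam, is_shape lam Y & antipode_free d (bead lam).

(** When there is a twin, the move is the double move of
    [antipode_free_double].  When there is none, the reflected move is not
    available, so by [antipode_free_single] the single move is harmless. *)
Lemma balanced_options a b Y P :
  balanced (b%:Z - a%:Z)%R Y -> P \in options a b Y ->
  balanced (b%:Z - a%:Z)%R P.
Proof.
set d := (b%:Z - a%:Z)%R.
move=> [lam shY free] /flattenP[s /mapP[[i j] xY ->]].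
have [l sp] := hook_spanE shY xY.
have i0 : 0 < i by case/andP: sp.
have shZ := remove_hook_shape shY sp; have beadZ := bead_cut shY sp.
have [lt_tu _] := hook_contents shY sp.
have neq_ut : head lam i <> tail j l by move=> e; rewrite e ltxx in lt_tu.
have bu := bead_head lam i0.
have tw := fun i' j' l' => @twinsP a b lam Y i j l i' j' l' shY sp.
rewrite /moves; case E : (twins a b Y (i, j)) => [|y0 r].
  rewrite inE => /eqP ->; exists (cut lam i j l) => //.
  apply: (antipode_free_ext beadZ).
  have [//|[bv' nbu']] := antipode_free_single free bu neq_ut.
  have lt_uv : (d - 1 - head lam i < d - 1 - tail j l)%R by lia.
  have [i' [j' [l' [sp' e1 e2]]]] := hook_of_beads shZ (proj2 (beadZ _) bv')
    (fun h => nbu' (proj1 (beadZ _) h)) lt_uv.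
  by have /(tw _ _ _ sp') : _ /\ _ := conj e1 e2; rewrite E.
rewrite -E => /mapP[[i' j'] yT ->].
have yZ : (i', j') \in remove_hook Y (i, j) by move: yT; rewrite mem_filter => /andP[].
have [l' sp'] := hook_spanE shZ yZ.
have [e1 e2] := proj1 (tw _ _ _ sp') yT.
exists (cut (cut lam i j l) i' j' l'); first exact: remove_hook_shape shZ sp'.
apply: antipode_free_ext (antipode_free_double free bu neq_ut) => z.
rewrite (bead_cut shZ sp') e1 e2 /shift_bead; split.
  by case=> [[/beadZ]|]; [left|right].
by case=> [[/beadZ]|]; [left|right].
Qed.

(** * Undoing moves by adding boxes *)

Definition grow (lam : nat -> nat) (i k : nat) : nat :=
  if k == i then (lam i).+1 else lam k.

(** The place next to the bead of row [i] is vacant exactly when row [i - 1],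
    if there is one, is strictly longer. *)
Lemma grow_shape lam Y i :
  is_shape lam Y -> 0 < i -> ~ bead lam (head lam i + 1)%R ->
  is_shape (grow lam i) ((i, (lam i).+1) |` Y).
Proof.
move=> shY i0 Nb; have [dec [N lam0] memY] := shY; split.
- move=> k k0; have := dec k k0; rewrite /grow.
  have [ki|_] := eqVneq k i; first by rewrite ki; case: eqVneq; lia.
  have [ki|//] := eqVneq k.+1 i => le_k.
  have [e|?] := eqVneq (lam k) (lam i); last by rewrite ki in le_k; lia.
  by case: Nb; exists k; rewrite // /head e; lia.
- exists (N + i) => k lt_k; rewrite /grow; case: eqVneq; first lia.
  by move=> _; apply: lam0; lia.
move=> p q; rewrite !inE memY xpair_eqE /grow.
have [->|ne] := eqVneq p i; lia.
Qed.

Lemma grow_span lam Y i :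
  is_shape lam Y -> 0 < i -> hook_span (grow lam i) i (lam i).+1 i.
Proof.
move=> [dec _ _] i0; have := dec i i0; rewrite /hook_span /grow eqxx.
by case: eqVneq; lia.
Qed.

Lemma grow_cut lam i k : cut (grow lam i) i (lam i).+1 i k = lam k.
Proof. by rewrite /cut /grow; case: (ltngtP k i) => [?|?|->]; repeat case: eqVneq; lia. Qed.

Lemma head_grow lam i : head (grow lam i) i = (head lam i + 1)%R.
Proof. by rewrite /head /grow eqxx; lia. Qed.

Lemma tail_grow lam i : tail (lam i).+1 i = head lam i.
Proof. by rewrite /head /tail; lia. Qed.

Lemma grow_remove lam Y i :
  is_shape lam Y -> 0 < i -> ~ bead lam (head lam i + 1)%R ->
  remove_hook ((i, (lam i).+1) |` Y) (i, (lam i).+1) = Y.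
Proof.
move=> shY i0 Nb; have shG := grow_shape shY i0 Nb.
apply: shape_ext (remove_hook_shape shG (grow_span shY i0)) shY _ => k _.
exact: grow_cut.
Qed.

Lemma bead_grow lam Y i z : is_shape lam Y -> 0 < i ->
  bead (grow lam i) z <-> shift_bead (bead lam) (head lam i) (head lam i + 1)%R z.
Proof.
move=> shY i0; split.
  case=> k k0 ->; rewrite /grow; have [->|ne] := eqVneq k i.
    by right; rewrite /head; lia.
  left; split; first by exists k.
  have := @bead_lt _ _ k i shY k0; have := @bead_lt _ _ i k shY i0.
  by rewrite /head; lia.
case=> [[[k k0 ->] ne]|->].
  by exists k; rewrite // /grow; case: eqVneq => // e; case: ne; rewrite e.
by exists i; rewrite // /grow eqxx /head; lia.
Qed.

Lemma moves_mem a b Y x P : x \in Y -> P \in moves a b Y x -> P \in options a b Y.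
Proof. by move=> xY Pm; apply/flattenP; exists (moves a b Y x) => //; apply: map_f. Qed.

(** Adding a box to row [i] moves the bead [u = head lam i] to [u + 1].  If no
    antipodal pair appears, removing that box again is a move without twin.
    Otherwise the antipode of [u + 1] is a bead; moving it up by one place adds a
    second box, and removing the second box has the first one as its twin.  The
    bound on [head lam i] places the second box in one of the first [a] rows. *)
Lemma predecessor a b lam Y i :
  let d : int := (b%:Z - a%:Z)%R in
  is_shape lam Y -> antipode_free d (bead lam) ->
  (forall k, a < k -> lam k = 0) ->
  0 < i <= a -> (head lam i + 2 <= b%:Z)%R -> ~ bead lam (head lam i + 1)%R ->
  exists P mu, [/\ is_shape mu P, antipode_free d (bead mu),
    forall k, a < k -> mu k = 0 & Y \in options a b P].
Proof.
move=> d shY free rows /andP[i0 le_ia] le_ub Nb.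
set u := head lam i in le_ub Nb *; set mu := grow lam i.
have bu := bead_head lam i0; rewrite -/u in bu.
have shZ := grow_shape shY i0 Nb; set x := (i, (lam i).+1) in shZ.
set Z := x |` Y in shZ; have beadZ z := bead_grow z shY i0.
have spZ := grow_span shY i0.
have remZ : remove_hook Z x = Y := grow_remove shY i0 Nb.
have rowsZ k : a < k -> mu k = 0.
  by move=> lt_ak; rewrite /mu /grow; case: eqVneq; [lia | rewrite rows].
have xZ : x \in Z by rewrite !inE eqxx.
have neq : u <> (u + 1)%R by lia.
have [free1|[bv' nbu']] := antipode_free_single free bu neq.
  (* A twin would start from the antipode of [u], which is vacant. *)
  exists Z, mu; split=> //; first exact: antipode_free_ext beadZ free1.
  apply: (moves_mem xZ); rewrite /moves.
  case E : (twins a b Z x) => [|y r]; first by rewrite remZ inE.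
  have : y \in twins a b Z x by rewrite E mem_head.
  case: y E => i' j' _ yT.
  have yY : (i', j') \in remove_hook Z x by move: yT; rewrite mem_filter => /andP[].
  have [l' sp'] := hook_spanE (remove_hook_shape shZ spZ) yY.
  have [e1 _] := proj1 (twinsP a b shZ spZ sp') yT.
  case: (free u bu); rewrite -/d tail_grow in e1; rewrite -e1.
  exists i'; first by case/andP: sp'.
  by rewrite /head grow_cut.
have [i' i'0 e] := proj2 (beadZ _) bv'.
have e1 : head mu i' = (d - 1 - (u + 1))%R by [].
have e2 : (head mu i' + 1 = d - 1 - u :> int)%R by rewrite e1; lia.
have Nb' : ~ bead mu (head mu i' + 1)%R by rewrite e2 => /beadZ.
set y := (i', (mu i').+1).
have shP := grow_shape shZ i'0 Nb'; rewrite -/y in shP.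
have spP := grow_span shZ i'0.
have remP : remove_hook (y |` Z) y = Z := grow_remove shZ i'0 Nb'.
have le_i'a : i' <= a.
  rewrite leqNgt; apply/negP => lt_ai'; have := rowsZ _ lt_ai'.
  by move: e1; rewrite {1}/head /d; lia.
exists (y |` Z), (grow mu i'); split=> //.
- apply: antipode_free_ext (antipode_free_double free bu neq) => z.
  rewrite (bead_grow _ shZ i'0) e2 e1.
  by split; (case=> [[/beadZ]|]; [left|right]).
- move=> k lt_ak; rewrite /grow; case: eqVneq; first lia.
  by rewrite rowsZ.
apply: (@moves_mem _ _ _ y); first by rewrite !inE eqxx.
have spZ' : hook_span (cut (grow mu i') i' (mu i').+1 i') i (lam i).+1 i.
  by move: spZ; rewrite /hook_span !grow_cut.
have xT : x \in twins a b (y |` Z) y.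
  apply/(twinsP a b shP spP spZ'); rewrite !tail_grow head_grow e1.
  rewrite /head grow_cut -/(head mu i) head_grow.
  by rewrite -/d /u /head; split; lia.
rewrite /moves; case E : (twins a b (y |` Z) y) xT => [//|t r]; rewrite -E => xT.
by rewrite -{1}remZ -[Z in remove_hook Z x]remP map_f.
Qed.

(** * Reachable positions *)

Definition rect_rows (a b k : nat) : nat := if 0 < k <= a then b else 0.

Lemma rect_shape a b : is_shape (rect_rows a b) (rect a b).
Proof.
split.
- by move=> k k0; rewrite /rect_rows; do 2 case: ifP; lia.
- by exists a => k lt_ak; rewrite /rect_rows; case: ifP; lia.
move=> i j; rewrite inE /rect_rows; apply/allpairsP/idP => [[[p q] /=]|h].
  by rewrite !mem_iota => -[? ? [-> ->]]; case: ifP; lia.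
by exists (i, j); rewrite !mem_iota /=; move: h; case: ifP; split=> //; lia.
Qed.

Lemma balanced_rect a b : a <= b -> balanced (b%:Z - a%:Z)%R (rect a b).
Proof.
move=> le_ab; exists (rect_rows a b); first exact: rect_shape.
move=> z [i i0 ->] [k k0]; rewrite /rect_rows; do 2 case: ifP; lia.
Qed.

Lemma balanced_reachable a b Y :
  a <= b -> reachable a b Y -> balanced (b%:Z - a%:Z)%R Y.
Proof.
move=> le_ab [s]; elim/last_ind: s Y => [|s P IH] Y /=.
  by move=> _ <-; apply: balanced_rect.
rewrite rcons_path last_rcons => /andP[path_s PO] <-.
exact: balanced_options (IH _ path_s erefl) PO.
Qed.

Lemma reachable_step a b P Y : reachable a b P -> Y \in options a b P -> reachable a b Y.
Proof.
move=> [s path_s lastP] YO; exists (rcons s Y); last by rewrite last_rcons.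
by rewrite rcons_path path_s lastP.
Qed.

(** If the first row were longer than [b], the antipode of its bead would be a
    bead of an empty row below row [a]. *)
Lemma balanced_sub_rect a b lam Y : a <= b ->
  is_shape lam Y -> antipode_free (b%:Z - a%:Z)%R (bead lam) ->
  (forall k, a < k -> lam k = 0) -> Y `<=` rect a b.
Proof.
move=> le_ab shY free rows.
have le1 : lam 1 <= b.
  rewrite leqNgt; apply/negP => lt_b1; apply: (free _ (bead_head lam (isT : 0 < 1))).
  have lt_a : a < lam 1 + a - b by lia.
  by exists (lam 1 + a - b); first lia; rewrite rows // /head; lia.
have [_ _ memY] := shY; have [_ _ memR] := rect_shape a b.
apply/fsubsetP => -[i j]; rewrite memY memR => /and3P[i0 j0 le_j].
have := shape_mono shY (isT : 0 < 1) i0; rewrite /rect_rows i0 j0 /=.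
by case: (leqP i a) => [|/rows]; lia.
Qed.

(** By induction on the number of boxes missing from the rectangle; the first
    row shorter than [b] can always be extended. *)
Lemma reachable_of_balanced a b lam Y : a <= b ->
  is_shape lam Y -> antipode_free (b%:Z - a%:Z)%R (bead lam) ->
  (forall k, a < k -> lam k = 0) -> reachable a b Y.
Proof.
move=> le_ab.
have [N] := ubnP (#|` rect a b| - #|` Y|); elim: N Y lam => // N IH Y lam ltN shY free rows.
have subR := balanced_sub_rect le_ab shY free rows.
pose short k := (0 < k <= a) && (lam k < b).
have [[k0 shortk]|full] := classic (exists k, short k); last first.
  exists [::] => //=; apply: (shape_ext (rect_shape a b) shY) => k kpos.
  rewrite /rect_rows kpos /=; case: (leqP k a) => [le_ka|/rows //].
  have le_kb : b <= lam k.
    by rewrite leqNgt; apply/negP => lt_kb; apply: full; exists k; rewrite /short kpos le_ka.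
  have [_ _ memY] := shY; have [_ _ memR] := rect_shape a b.
  have [lt0|] := ltnP 0 (lam k); last by lia.
  have := fsubsetP subR (k, lam k).
  by rewrite memY memR kpos lt0 leqnn /= /rect_rows kpos le_ka /= => /(_ isT); lia.
have [i /andP[/andP[i0 le_ia] lt_ib] mini] := ex_minnP (ex_intro short k0 shortk).
have Nb : ~ bead lam (head lam i + 1)%R.
  case=> k kpos e; have [lt_ki|le_ik] := ltnP k i.
    have [lt_kb|le_bk] := ltnP (lam k) b; last by rewrite /head in e; lia.
    by have := mini k; rewrite /short kpos lt_kb; lia.
  by have := shape_mono shY i0 le_ik; rewrite /head in e; lia.
have le_u : (head lam i + 2 <= b%:Z)%R by rewrite /head; lia.
have ia : 0 < i <= a by rewrite i0.
have [P [mu [shP freeP rowsP YP]]] := predecessor shY free rows ia le_u Nb.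
apply: (reachable_step (IH _ _ _ shP freeP rowsP) YP).
have := options_card YP; have := fsubset_leq_card (balanced_sub_rect le_ab shP freeP rowsP).
by move: ltN; rewrite ltnS; lia.
Qed.

Lemma positionsP a b Y : a <= b ->
  positions a b Y <-> young_rows a Y /\ balanced (b%:Z - a%:Z)%R Y.
Proof.
move=> le_ab; split=> [[[[lam shY] subR] reachY]|[[lam shY rows] [mu shY' free]]].
  split; last exact: balanced_reachable.
  exists lam => // i lt_ai; case E : (lam i) => [//|k].
  have [_ _ memY] := shY; have [_ _ memR] := rect_shape a b.
  have := fsubsetP subR (i, 1); rewrite memY memR E /rect_rows.
  by case: ifP; lia.
have rows' i : a < i -> mu i = 0.
  by move=> lt_ai; rewrite -(shape_inj shY shY') ?rows //; lia.
split; last exact: reachable_of_balanced shY' free rows'.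
by split; [exists lam | apply: balanced_sub_rect shY' free rows'].
Qed.

(** * Shifting the numbering *)

Lemma options_shift a b c Y : options (a + c) (b + c) Y = options a b Y.
Proof.
have shiftE (s : seq (nat * nat)) : [seq numbering (a + c) (b + c) y | y <- s] =
    [seq (z + c%:Z)%R | z <- [seq numbering a b y | y <- s]].
  by rewrite -map_comp; apply: eq_map => y; rewrite /numbering /=; lia.
have eq_hook Z W x y :
    (hook_numbers (a + c) (b + c) Z x == hook_numbers (a + c) (b + c) W y)
    = (hook_numbers a b Z x == hook_numbers a b W y).
  rewrite /hook_numbers !shiftE.
  apply/eqP/eqP => /eq_seq_msetP eq_s; apply/eq_seq_msetP; last exact: perm_map.
  by apply: perm_map_inj eq_s; apply: addIr.
rewrite /options; congr flatten; apply: eq_map => x.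
have eq_tw : twins (a + c) (b + c) Y x = twins a b Y x.
  by apply: eq_filter => y; rewrite eq_hook.
by rewrite /moves eq_tw.
Qed.

Lemma grundy_shift a b c Y : grundy (a + c) (b + c) Y = grundy a b Y.
Proof.
rewrite /grundy; move: #|` Y| => k; elim: k Y => //= k IH Y.
by rewrite options_shift; congr mex; apply: eq_map.
Qed.

(** * Comparison of the two games *)

Theorem theorem1p2 (t m n : nat) (Y : {fset nat * nat})
    (m_gt0 : 0 < m) (n_gt0 : 0 < n) (le_tm : t <= m) (le_mn : m <= n)
    (rowsY : young_rows t Y) :
  (positions m n Y <-> positions t (n - m + t) Y)
  /\ (positions m n Y -> grundy m n Y = grundy t (n - m + t) Y).
Proof.
split.
  have eq_d : ((n - m + t)%N%:Z - t%:Z = n%:Z - m%:Z :> int)%R by lia.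
  rewrite !positionsP ?eq_d //; last by lia.
  split=> -[_ balY]; split=> //; have [lam shY rows] := rowsY.
  by exists lam => // i lt_mi; apply: rows; lia.
move=> _; rewrite -(grundy_shift t (n - m + t) (m - t)).
by congr grundy; lia.
Qed.
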